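(* Let $\mathcal{G}=(\mathcal{N},\mathcal{E})$ be a connected undirected graph with $n\ge 2$ nodes, and let $\mathbf{W}$ be a mixing matrix on $\mathcal{G}$ with $\lambda_{\mathbf{W}}<1$. Then $$\tau_{\mathbf{W}}=\frac{1}{1-\lambda_{\mathbf{W}}}\ge\frac{D_{\mathcal{G}}-1}{\log n}.$$
   Context: Graphs have node set $\mathcal{N}=\{1,\dots,n\}$ and no self-loops. $D_{\mathcal{G}}$ is the diameter of $\mathcal{G}$ (maximum shortest-path distance over pairs of nodes). $\log$ is the natural logarithm. A real $n\times n$ matrix $\mathbf{W}$ is a mixing matrix on a connected undirected graph $\mathcal{G}$ if it is entrywise nonnegative, symmetric, doubly stochastic, and for all $i\ne j$: $[\mathbf{W}]_{ij}>0$ if and only if $\{i,j\}$ is an edge of $\mathcal{G}$ (diagonal entries are unrestricted apart from nonnegativity). With $\mathbf{J}=\mathbf{1}\mathbf{1}^\top/n$ and $\|\cdot\|_2$ the spectral norm, $\lambda_{\mathbf{W}}:=\|\mathbf{W}-\mathbf{J}\|_2$, and $\tau_{\mathbf{W}}:=1/(1-\lambda_{\mathbf{W}})$ when $\lambda_{\mathbf{W}}<1$. *)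

(* Defs.v *)
From HB Require Import structures.
From mathcomp Require Import all_boot all_order all_algebra.
From mathcomp Require Import all_classical all_reals.

Set Implicit Arguments.
Unset Strict Implicit.
Unset Printing Implicit Defensive.

Import Order.TTheory GRing.Theory Num.Theory.

Local Open Scope classical_set_scope.
Local Open Scope ring_scope.

Definition has_walk (T : finType) (e : rel T) (x y : T) (k : nat) : bool :=
  [exists p : k.-tuple T, path e x p && (last x p == y)].

(* A shortest walk is a path, so it has fewer than #|T| edges.  The distance
   takes the default value #|T| when y is not reachable from x. *)
Definition gdist (T : finType) (e : rel T) (x y : T) : nat :=
  find (has_walk e x y) (iota 0 #|T|).

Definition diameter (T : finType) (e : rel T) : nat :=
  (\max_(x : T) \max_(y : T) gdist e x y)%N.

Record mixing_matrix (R : realType) (n : nat) (e : rel 'I_n) (W : 'M[R]_n)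
    : Prop := MixingMatrix {
  mixing_ge0 : forall i j, 0 <= W i j;
  mixing_sym : W^T = W;
  mixing_row_sum : forall i, \sum_j W i j = 1;
  mixing_col_sum : forall j, \sum_i W i j = 1;
  mixing_edge : forall i j, i != j -> (0 < W i j) = e i j
}.

Definition l2norm (R : realType) (n : nat) (x : 'cV[R]_n) : R :=
  Num.sqrt (\sum_i x i 0 ^+ 2).

Definition spectral_norm (R : realType) (m n : nat) (A : 'M[R]_(m, n)) : R :=
  sup [set l2norm (A *m x) | x in [set x : 'cV[R]_n | l2norm x <= 1]].

Definition avg_mx (R : realType) (n : nat) : 'M[R]_n :=
  n%:R^-1 *: ((const_mx 1 : 'cV[R]_n) *m (const_mx 1 : 'cV[R]_n)^T).

Definition mixing_lambda (R : realType) (n : nat) (W : 'M[R]_n) : R :=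
  spectral_norm (W - avg_mx R n).

Definition mixing_tau (R : realType) (n : nat) (W : 'M[R]_n) : R :=
  1 / (1 - mixing_lambda W).

(* Main.v *)
Require Import Defs.
From mathcomp Require Import all_boot all_order all_algebra.
From mathcomp Require Import all_classical all_reals all_analysis.

Import Order.TTheory GRing.Theory Num.Theory.

(** Each application of [W] moves mass along at most one edge, so if [x] and [y]
    realise the diameter [D] then [k = D - 1] steps do not suffice to go from
    [x] to [y]: the entry [(W ^+ k) x y] vanishes ([mixing_expr_walk]).  On the
    other hand [W] fixes the averaging projection [J] on both sides, whence
    [(W - J) ^+ k = W ^+ k - J] as soon as [k >= 1] ([expr_sub_absorbing]).
    The [(x, y)] entry of this matrix is therefore exactly [- 1 / n], while
    every entry of [(W - J) ^+ k] is at most [lambda ^+ k] in absolute value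
    because the spectral norm is submultiplicative along powers
    ([entry_expr_le_spectral_norm]).  Thus [1 / n <= lambda ^+ k]; taking
    logarithms and using [ln lambda <= lambda - 1] gives
    [k * (1 - lambda) <= ln n], which is the claim.  When [D <= 1] the
    left-hand side is nonpositive. *)

Local Open Scope ring_scope.

(** * The Euclidean norm and the spectral norm *)

Lemma sum_sqr_ge0 {R : realType} {n : nat} (x : 'cV[R]_n) :
  0 <= \sum_i x i 0 ^+ 2.
Proof. by apply: sumr_ge0 => i _; apply: sqr_ge0. Qed.

Lemma l2norm_ge0 {R : realType} {n : nat} (x : 'cV[R]_n) : 0 <= l2norm x.
Proof. exact: sqrtr_ge0. Qed.

Lemma l2normZ {R : realType} {n : nat} (a : R) (x : 'cV[R]_n) :
  l2norm (a *: x) = `|a| * l2norm x.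
Proof.
rewrite /l2norm -sqrtr_sqr -sqrtrM ?sqr_ge0// mulr_sumr.
by congr Num.sqrt; apply: eq_bigr => i _; rewrite mxE exprMn.
Qed.

Lemma entry_le_l2norm {R : realType} {n : nat} (x : 'cV[R]_n) (i : 'I_n) :
  `|x i 0| <= l2norm x.
Proof.
rewrite /l2norm -sqrtr_sqr ler_sqrt ?sum_sqr_ge0// (bigD1 i)//= lerDl.
by apply: sumr_ge0 => j _; apply: sqr_ge0.
Qed.

Lemma l2norm_eq0 {R : realType} {n : nat} (x : 'cV[R]_n) :
  l2norm x = 0 -> x = 0.
Proof.
move=> x0; apply/matrixP => i j; rewrite (ord1 j) mxE; apply/eqP.
by rewrite -normr_le0 -x0 entry_le_l2norm.
Qed.

Lemma l2norm_delta {R : realType} {n : nat} (i : 'I_n) :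
  l2norm (delta_mx i 0 : 'cV[R]_n) = 1.
Proof.
rewrite /l2norm (bigD1 i)//= big1 => [|j /negbTE ji]; last first.
  by rewrite mxE ji expr0n.
by rewrite mxE !eqxx expr1n addr0 sqrtr1.
Qed.

Lemma l2norm0 {R : realType} {n : nat} : l2norm (0 : 'cV[R]_n) = 0.
Proof. by rewrite -(scale0r 0) l2normZ normr0 mul0r. Qed.

(** Needed to use [sup] at all: the supremum of an unbounded set would be the
    default value [0].  The entries of a vector of the unit ball are at most
    [1], so [A *m x] is dominated entrywise by the absolute row sums of [A]. *)
Lemma spectral_norm_has_sup {R : realType} {m n : nat} (A : 'M[R]_(m, n)) :
  has_sup [set l2norm (A *m x) | x in [set x : 'cV[R]_n | l2norm x <= 1]]%classic.
Proof.
split; first by exists (l2norm (A *m 0)); exists 0 => //=; rewrite l2norm0.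
exists (l2norm (\col_i \sum_j `|A i j|)) => _ [x /= x1 <-].
rewrite /l2norm ler_sqrt ?sum_sqr_ge0//; apply: ler_sum => i _.
rewrite -real_normK ?num_real// !mxE lerXn2r ?nnegrE// ?sumr_ge0//.
apply: (le_trans (ler_norm_sum _ _ _)); apply: ler_sum => j _.
by rewrite normrM ler_piMr// (le_trans (entry_le_l2norm x j)).
Qed.

Lemma l2norm_mulmx_le {R : realType} {m n : nat} (A : 'M[R]_(m, n))
    (x : 'cV[R]_n) :
  l2norm (A *m x) <= spectral_norm A * l2norm x.
Proof.
have [/l2norm_eq0 ->|x_neq0] := eqVneq (l2norm x) 0.
  by rewrite mulmx0 !l2norm0 mulr0.
have x_gt0 : 0 < l2norm x by rewrite lt_def x_neq0 l2norm_ge0.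
rewrite -ler_pdivrMr// mulrC -[_^-1]ger0_norm ?invr_ge0 ?l2norm_ge0//.
rewrite -l2normZ scalemxAr; apply: (sup_upper_bound (spectral_norm_has_sup A)).
exists ((l2norm x)^-1 *: x) => //=.
by rewrite l2normZ ger0_norm ?invr_ge0 ?l2norm_ge0// mulVf.
Qed.

Lemma spectral_norm_ge0 {R : realType} {m n : nat} (A : 'M[R]_(m, n)) :
  0 <= spectral_norm A.
Proof.
apply: (sup_upper_bound (spectral_norm_has_sup A)).
by exists 0; rewrite /= ?mulmx0 l2norm0.
Qed.

Lemma l2norm_expr_le {R : realType} {n : nat} (A : 'M[R]_n) (k : nat)
    (x : 'cV[R]_n) :
  l2norm (A ^+ k *m x) <= spectral_norm A ^+ k * l2norm x.
Proof.
elim: k => [|k IHk]; first by rewrite !expr0 mul1mx mul1r.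
rewrite !exprS -[A * _]/(A *m _) -mulmxA -mulrA.
apply: (le_trans (l2norm_mulmx_le A _)).
by rewrite ler_wpM2l ?spectral_norm_ge0.
Qed.

(** Column [y] of [A ^+ k] is the image of a unit basis vector. *)
Lemma entry_expr_le_spectral_norm {R : realType} {n : nat} (A : 'M[R]_n)
    (k : nat) (x y : 'I_n) :
  `|(A ^+ k) x y| <= spectral_norm A ^+ k.
Proof.
have := l2norm_expr_le A k (delta_mx y 0).
rewrite l2norm_delta mulr1; apply: le_trans.
by rewrite -colE; have := entry_le_l2norm (col y (A ^+ k)) x; rewrite mxE.
Qed.

(** * Powers of a mixing matrix *)

(** The cross terms of [(w - j) * (w ^+ k - j)] cancel: each of [w * j],
    [j * w ^+ k] and [j * j] equals [j].  The exponent must be positive, since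
    [(w - j) ^+ 0 = 1]. *)
Lemma expr_sub_absorbing {S : pzRingType} (w j : S) (k : nat) :
  w * j = j -> j * w = j -> j * j = j ->
  (w - j) ^+ k.+1 = w ^+ k.+1 - j.
Proof.
move=> wj jw jj; elim: k => [|k IHk]; first by rewrite !expr1.
have jwk m : j * w ^+ m = j.
  by elim: m => [|m IHm]; rewrite ?expr0 ?mulr1// exprS mulrA jw.
rewrite exprS IHk mulrBl !mulrBr wj jj jwk -exprS.
by rewrite subrr subr0.
Qed.

Lemma avg_mxE {R : realType} {n : nat} (i j : 'I_n) :
  avg_mx R n i j = n%:R^-1.
Proof. by rewrite !mxE big_ord1 !mxE !mulr1. Qed.

Lemma mulmx_avg {R : realType} {n : nat} (A : 'M[R]_n) :
  (forall i, \sum_j A i j = 1) -> A *m avg_mx R n = avg_mx R n.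
Proof.
move=> A1; apply/matrixP => i j; rewrite mxE avg_mxE.
under eq_bigr do rewrite avg_mxE.
by rewrite -mulr_suml A1 mul1r.
Qed.

Lemma avg_mulmx {R : realType} {n : nat} (A : 'M[R]_n) :
  (forall j, \sum_i A i j = 1) -> avg_mx R n *m A = avg_mx R n.
Proof.
move=> A1; apply/matrixP => i j; rewrite mxE avg_mxE.
under eq_bigr do rewrite avg_mxE.
by rewrite -mulr_sumr A1 mulr1.
Qed.

Lemma avg_row_sum {R : realType} {n : nat} (i : 'I_n) :
  \sum_j avg_mx R n i j = 1.
Proof.
under eq_bigr do rewrite avg_mxE.
rewrite sumr_const card_ord -[LHS]mulr_natl mulfV// pnatr_eq0.
by case: n i => // -[].
Qed.

Lemma mixing_sub_avg_expr {R : realType} {n : nat} {e : rel 'I_n}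
    {W : 'M[R]_n} (k : nat) :
  mixing_matrix e W ->
  (W - avg_mx R n) ^+ k.+1 = W ^+ k.+1 - avg_mx R n.
Proof.
move=> Wmix; apply: expr_sub_absorbing.
- exact: mulmx_avg (mixing_row_sum Wmix).
- exact: avg_mulmx (mixing_col_sum Wmix).
- exact: mulmx_avg avg_row_sum.
Qed.

(** A nonzero entry of [W ^+ k] comes from a sequence of [k] steps of [W], each
    of which follows an edge or stays in place; removing the idle steps leaves a
    walk, possibly shorter than [k]. *)
Lemma mixing_expr_walk {R : realType} {n : nat} {e : rel 'I_n}
    {W : 'M[R]_n} (k : nat) (x y : 'I_n) :
  mixing_matrix e W -> (W ^+ k) x y != 0 ->
  exists2 j, (j <= k)%N & has_walk e x y j.
Proof.
move=> Wmix; elim: k x => [|k IHk] x.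
  rewrite expr0 mxE; have [-> _|_] := eqVneq x y; last by rewrite eqxx.
  by exists 0%N => //; apply/existsP; exists [tuple]; rewrite /= eqxx.
rewrite exprS mxE => Wxy.
have [z Wxz] : exists z, W x z * (W ^+ k) z y != 0.
  apply/existsP; apply: contraNT Wxy; rewrite negb_exists => /forallP W0.
  by apply/eqP/big1 => z _; apply/eqP; have := W0 z; rewrite negbK.
move: Wxz; rewrite mulf_eq0 negb_or => /andP[Wxz /IHk[j jk walk_j]].
have [zx|xz] := eqVneq x z; first by exists j; rewrite ?zx// (leq_trans jk).
have exz : e x z by rewrite -(mixing_edge Wmix) // lt_def Wxz (mixing_ge0 Wmix).
exists j.+1 => //; have /existsP[p /andP[path_p last_p]] := walk_j.
by apply/existsP; exists [tuple of z :: p]; rewrite /= exz path_p.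
Qed.

(** * Distances *)

Lemma no_walk_lt_gdist {T : finType} (e : rel T) (x y : T) (k : nat) :
  (k < gdist e x y)%N -> ~~ has_walk e x y k.
Proof.
move=> kd; have := before_find 0%N kd.
have kT : (k < #|T|)%N.
  by rewrite (leq_trans kd)// -[leqRHS](size_iota 0) find_size.
by rewrite nth_iota// add0n => ->.
Qed.

Lemma diameter_attained {T : finType} (e : rel T) :
  (0 < #|T|)%N -> exists x y, gdist e x y = diameter e.
Proof.
move=> T0; rewrite /diameter.
have [x ->] := bigop.eq_bigmax (fun x => \max_y gdist e x y)%N T0.
by have [y ->] := bigop.eq_bigmax (gdist e x) T0; exists x, y.
Qed.

(** The entry of [(W - J) ^+ k.+1] at a pair that [k.+1] steps cannot join is
    [- 1 / n], and its absolute value is at most [lambda ^+ k.+1]. *)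
Lemma mixing_lambda_expr_ge {R : realType} {n : nat} {e : rel 'I_n}
    {W : 'M[R]_n} (k : nat) (x y : 'I_n) :
  mixing_matrix e W -> (k.+1 < gdist e x y)%N ->
  n%:R^-1 <= mixing_lambda W ^+ k.+1.
Proof.
move=> Wmix kd; have Wxy : (W ^+ k.+1) x y = 0.
  apply/eqP; apply/negPn/negP => /(mixing_expr_walk _ _ _ Wmix)[j jk].
  by apply/negP/no_walk_lt_gdist/(leq_ltn_trans jk).
have := entry_expr_le_spectral_norm (W - avg_mx R n) k.+1 x y.
rewrite (mixing_sub_avg_expr k Wmix) mxE Wxy add0r mxE avg_mxE normrN.
by rewrite ger0_norm ?invr_ge0.
Qed.

(** * The bound on the relaxation time *)

(** Taking logarithms, [- ln n <= k.+1 * ln l <= k.+1 * (l - 1)]. *)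
Lemma expr_gap_le_ln {R : realType} (n k : nat) (l : R) :
  (0 < n)%N -> 0 <= l -> n%:R^-1 <= l ^+ k.+1 ->
  k.+1%:R * (1 - l) <= ln n%:R.
Proof.
move=> n0 l0 nl; have n0R : 0 < n%:R :> R by rewrite ltr0n.
have l_gt0 : 0 < l.
  rewrite lt_def l0 andbT; apply: contraTneq nl => ->.
  by rewrite expr0n -ltNge invr_gt0.
have ln_n : - ln n%:R <= ln l *+ k.+1.
  by rewrite -lnXn// -lnV ?posrE// ler_ln ?posrE ?invr_gt0// exprn_gt0.
have ln_l : ln l <= l - 1.
  by rewrite -[in ln l](subrKC 1 l) le_ln1Dx// ltrBrDr addNr.
rewrite -lerN2 (le_trans ln_n)// -mulrN opprB mulr_natl.
exact: ler_wMn2r.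
Qed.

Theorem theorem2p2 (R : realType) (n : nat) (n_ge2 : (2 <= n)%N)
    (e : rel 'I_n) (e_sym : symmetric e) (e_irr : irreflexive e)
    (e_conn : forall x y : 'I_n, connect e x y)
    (W : 'M[R]_n) (W_mix : mixing_matrix e W)
    (W_lt1 : mixing_lambda W < 1) :
  ((diameter e)%:R - 1) / ln n%:R <= mixing_tau W.
Proof.
have n_gt0 : (0 < n)%N by apply: ltnW.
have ln_gt0 : 0 < ln n%:R :> R by rewrite ln_gt0// ltr1n.
have gap_gt0 : 0 < 1 - mixing_lambda W by rewrite subr_gt0.
rewrite /mixing_tau ler_pdivrMr// mulrAC mul1r ler_pdivlMr//.
have card_gt0 : (0 < #|'I_n|)%N by rewrite card_ord.
have [x [y]] := diameter_attained e card_gt0.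
case: (diameter e) => [|[|k]] dxy.
- by rewrite (le_trans _ (ltW ln_gt0))// sub0r mulN1r oppr_le0 ltW.
- by rewrite subrr mul0r ltW.
rewrite -natr1 addrK; apply: expr_gap_le_ln => //.
  exact: spectral_norm_ge0.
by apply: (mixing_lambda_expr_ge k x y W_mix); rewrite dxy.
Qed.
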